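(* Let $X$ be a graph and $\sim$ an equivalence relation on $V_X$. Assume that the quotient graph $X/\!\sim$ is connected and pseudo-covered by $X$ (with respect to $\sim$). If there exists an equivalence class $[x]$ ($x\in V_X$) such that $[x]\subseteq V_{C_X(x)}$, then $X$ is connected.
   Context: All graphs are finite, undirected, simple and reflexive: a graph $X=(V_X,E_X)$ has a finite nonempty vertex set $V_X$, and $E_X$ consists of all loops $\{x\}$ ($x\in V_X$; written $\{x,x\}$) together with a (possibly empty) set of $2$-element subsets of $V_X$. $C_X(x)$ denotes the component (maximal connected subgraph) of $X$ containing $x$, and $V_{C_X(x)}$ its vertex set. The quotient graph $X/\!\sim$ has as vertices the equivalence classes $[x]$, and $\{[x_1],[x_2]\}$ is an edge iff there are $\tilde x_1\sim x_1$, $\tilde x_2\sim x_2$ with $\{\tilde x_1,\tilde x_2\}\in E_X$. A homomorphism $\varphi:X\to Y$ is a map $V_X\to V_Y$ sending edges to edges (a proper edge may be mapped to a loop). It is locally strong if for all $x_1,x_2\in V_X$, $\{\varphi(x_1),\varphi(x_2)\}\in E_Y$ implies that for every $\tilde x_1\in\varphi^{-1}(\varphi(x_1))$ there exists $\tilde x_2\in\varphi^{-1}(\varphi(x_2))$ with $\{\tilde x_1,\tilde x_2\}\in E_X$. It is pseudo-covering if it is locally strong and surjective on vertices. $X/\!\sim$ is pseudo-covered by $X$ if the projection $\pi:X\to X/\!\sim$, $\pi(x)=[x]$, is pseudo-covering. *)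

(* Defs.v *)
From HB Require Import structures.
From mathcomp Require Import all_boot.
From mathcomp Require Import generic_quotient.

Set Implicit Arguments.
Unset Strict Implicit.
Unset Printing Implicit Defensive.

(* Finite undirected simple reflexive graphs. The edge set is encoded by the
   relation [adj x y], meaning {x, y} \in E_X; loops correspond to [adj x x]. *)
Record graph := Graph {
  vertex :> finType;
  adj : rel vertex;
  adj_refl : reflexive adj;
  adj_sym : symmetric adj;
  vertex_gt0 : 0 < #|vertex|
}.

Arguments adj {g}.

Definition connected (X : graph) : Prop :=
  forall x y : X, connect adj x y.

(* Vertex set of the component of [x]; [component_connected] and
   [component_max] below show that it spans the largest connected subgraph
   containing [x]. *)
Definition component (X : graph) (x : X) : {set X} :=
  [set y | connect adj x y].

Definition induced_adj (X : graph) (A : {set X}) : rel X :=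
  [rel u v | [&& u \in A, v \in A & adj u v]].

Definition connected_set (X : graph) (A : {set X}) : Prop :=
  {in A &, forall y z, connect (induced_adj A) y z}.

Lemma mem_component (X : graph) (x : X) : x \in component x.
Proof. by rewrite inE connect0. Qed.

Lemma component_connected (X : graph) (x : X) : connected_set (component x).
Proof.
set A := component x; set e := induced_adj A.
have sym_e : connect_sym e.
  by apply: sym_connect_sym => u v; rewrite /e /induced_adj /= adj_sym andbCA.
suff xA z : z \in A -> connect e x z.
  move=> y z Ay Az; apply: connect_trans (xA z Az).
  by rewrite sym_e; apply: xA.
rewrite inE => /connectP[p + ->].
elim/last_ind: p => [|p y IHp] /=; first by rewrite connect0.
rewrite rcons_path last_rcons => /andP[xp lyp].
apply: connect_trans (IHp xp) (connect1 _); rewrite /e /induced_adj /=.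
have xl : connect adj x (last x p) by apply/connectP; exists p.
by rewrite !inE xl (connect_trans xl (connect1 lyp)) lyp.
Qed.

Lemma component_max (X : graph) (x : X) (A : {set X}) :
  connected_set A -> x \in A -> A \subset component x.
Proof.
move=> cA Ax; apply/subsetP => y Ay; rewrite inE.
apply: connect_sub (cA x y Ax Ay) => u v /= /and3P[_ _].
exact: connect1.
Qed.

Definition homomorphism (X Y : graph) (f : X -> Y) : Prop :=
  forall x1 x2 : X, adj x1 x2 -> adj (f x1) (f x2).

Definition locally_strong (X Y : graph) (f : X -> Y) : Prop :=
  forall x1 x2 : X, adj (f x1) (f x2) ->
  forall t1 : X, f t1 = f x1 -> exists2 t2 : X, f t2 = f x2 & adj t1 t2.

Definition pseudo_covering (X Y : graph) (f : X -> Y) : Prop :=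
  [/\ homomorphism f, locally_strong f & forall y : Y, exists x : X, f x = y].

Section Quotient.

Variables (X : graph) (r : equiv_rel X).

Definition eqclass (x : X) : {set X} := [set y | r x y].

Definition quot_vertex : finType :=
  {A : {set X} | A \in equivalence_partition r [set: X]}.

Lemma eqclass_in_partition (x : X) :
  eqclass x \in equivalence_partition r [set: X].
Proof.
by apply/imsetP; exists x => //; apply/setP => y; rewrite !inE.
Qed.

Definition quot_proj (x : X) : quot_vertex :=
  exist _ (eqclass x) (eqclass_in_partition x).

Definition quot_adj : rel quot_vertex :=
  [rel A B : quot_vertex |
    [exists x1 in val A, exists x2 in val B, adj x1 x2]].

Lemma quot_adj_refl : reflexive quot_adj.
Proof.
case=> A /= PA; have /imsetP[x _ defA] := PA.
have Ax : x \in A by rewrite defA !inE equiv_refl.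
by apply/exists_inP; exists x => //; apply/exists_inP; exists x => //;
  apply: adj_refl.
Qed.

Lemma quot_adj_sym : symmetric quot_adj.
Proof.
move=> A B; apply/exists_inP/exists_inP => -[x Ax /exists_inP[y By xy]];
by exists y => //; apply/exists_inP; exists x => //; rewrite adj_sym.
Qed.

Lemma quot_vertex_gt0 : 0 < #|quot_vertex|.
Proof.
have /card_gt0P[x _] := vertex_gt0 X.
by apply/card_gt0P; exists (quot_proj x).
Qed.

Definition quot_graph : graph :=
  Graph quot_adj_refl quot_adj_sym quot_vertex_gt0.

Definition pseudo_covered : Prop :=
  @pseudo_covering X quot_graph quot_proj.

End Quotient.

(* Main.v *)
Require Import Defs.
From mathcomp Require Import all_boot.
From mathcomp Require Import generic_quotient.

(** Paths lift along a pseudo-covering from any prescribed start. Lifting a quotient path from the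
    class of [y] to the class of [x] joins [y] to some [t] in the latter class, which lies in the
    component of [x]; hence every [y] is connected to [x]. *)

Lemma pseudo_covering_lift_connect (X Y : graph) (f : X -> Y) (x : X) (y : Y) :
  pseudo_covering f -> connect adj (f x) y ->
  exists2 t : X, f t = y & connect adj x t.
Proof.
case=> _ f_strong f_surj /connectP[p].
elim: p x => [|z p IHp] x /=; first by move=> _ ->; exists x.
(* [x2] need not be adjacent to [x]: it only presents [z] as an image, so that local strength yields
   a neighbour [t2] of [x] in the same fibre. *)
have [x2 <-] := f_surj z; case/andP=> fx_fx2 p_path y_last.
have [t2 ft2 x_t2] := f_strong x x2 fx_fx2 x erefl.
rewrite -ft2 in p_path y_last.
have [t ft t2_t] := IHp t2 p_path y_last.
by exists t => //; apply: connect_trans (connect1 x_t2) t2_t.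
Qed.

Theorem corollary5p15 (X : graph) (r : equiv_rel X)
    (quot_connected : connected (quot_graph r))
    (quot_covered : pseudo_covered r)
    (class_in_component : exists x : X, eqclass r x \subset component x) :
  connected X.
Proof.
have [x /subsetP x_comp] := class_in_component.
have X_sym : connect_sym (@adj X) := sym_connect_sym (@adj_sym X).
suff to_x y : connect adj y x.
  by move=> y z; apply: connect_trans (to_x y) _; rewrite X_sym.
have [t /(congr1 val)/= class_t y_t] := pseudo_covering_lift_connect _ _ _ _ _
  quot_covered (quot_connected (quot_proj r y) (quot_proj r x)).
apply: connect_trans y_t _; rewrite X_sym.
(* [t] lies in its own class, which as a set is that of [x]. *)
have /x_comp : t \in eqclass r x by rewrite -class_t inE equiv_refl.
by rewrite inE.
Qed.
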